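(* Let $n_1\geq n_2\geq n_3\geq 0$ be integers, and let $\mathcal{C}$ be the capacity region of the linear shift deterministic Y-channel DYC$(n_1,n_2,n_3)$. Then $\mathcal{C}$ is outer bounded by $\overline{\mathcal{C}}$, i.e. $\mathcal{C}\subseteq\overline{\mathcal{C}}$, where $\overline{\mathcal{C}}$ is the set of all $\mathbf{R}=(R_{12},R_{13},R_{21},R_{23},R_{31},R_{32})\in\mathbb{R}_+^6$ satisfying \begin{align*} R_{12}+R_{32}+R_{13}&\leq n_2,\\ R_{12}+R_{32}+R_{31}&\leq n_1,\\ R_{21}+R_{31}+R_{32}&\leq n_2,\\ R_{21}+R_{31}+R_{23}&\leq n_2,\\ R_{13}+R_{23}+R_{12}&\leq n_2,\\ R_{13}+R_{23}+R_{21}&\leq n_1,\\ R_{31}+R_{32}&\leq n_3,\\ R_{13}+R_{23}&\leq n_3. \end{align*}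
   Context: The channel. $\mathbb{R}_+$ denotes the nonnegative reals. Let $n_1\ge n_2\ge n_3\ge 0$ be integers and $q=\max_j n_j=n_1$. Let $\mathbf{S}$ be the $q\times q$ down-shift matrix over $\mathbb{F}_2$, so that $\mathbf{S}^{m}$ shifts the entries of a vector down by $m$ positions, filling with zeros ($\mathbf{S}^0=I$). The linear shift deterministic Y-channel DYC$(n_1,n_2,n_3)$ has three users $1,2,3$ and a relay $r$, all full-duplex, with no direct links between users. At each time $i$, user $j$ sends $\mathbf{x}_{ji}\in\mathbb{F}_2^q$ and the relay sends $\mathbf{x}_{ri}\in\mathbb{F}_2^q$; the relay and user $j$ receive, respectively, $$\mathbf{y}_{ri}=\sum_{j=1}^3\mathbf{S}^{q-n_j}\mathbf{x}_{ji},\qquad \mathbf{y}_{ji}=\mathbf{S}^{q-n_j}\mathbf{x}_{ri},$$ with all operations over $\mathbb{F}_2$. Codes. Let $R_{jk}\in\mathbb{R}_+$ for all distinct $j,k\in\{1,2,3\}$. User $j$ has a message $m_{jk}$ for user $k$, uniformly distributed over the set $\mathcal{M}_{jk}=\{1,\dots,2^{nR_{jk}}\}$; the six messages are independent. A code of length $n$ for the rate tuple $\mathbf{R}=(R_{12},R_{13},R_{21},R_{23},R_{31},R_{32})$ consists of these message sets; user encoders $\mathbf{x}_{ji}=f_{ji}(m_{jk},m_{jl},\mathbf{y}_{j1},\dots,\mathbf{y}_{j,i-1})$ for $\{j,k,l\}=\{1,2,3\}$ and $1\le i\le n$; relay encoders $\mathbf{x}_{ri}=f_{ri}(\mathbf{y}_{r1},\dots,\mathbf{y}_{r,i-1})$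 for $1\le i\le n$; and decoders $(\hat m_{kj},\hat m_{lj})=g_j(\mathbf{y}_{j1},\dots,\mathbf{y}_{jn},m_{jk},m_{jl})$ for each user $j$. An error occurs if $(\hat m_{kj},\hat m_{lj})\ne(m_{kj},m_{lj})$ for some user $j$. Achievability. The rate tuple $\mathbf{R}$ is achievable if there exists a sequence of such codes for $\mathbf{R}$ whose average error probability can be made arbitrarily small by increasing $n$. The capacity region $\mathcal{C}$ is the set of all achievable rate tuples. *)

(* Defs.v *)
From HB Require Import structures.
From mathcomp Require Import all_boot all_order all_algebra.
From mathcomp Require Import all_classical all_reals all_analysis.
Import Order.TTheory GRing.Theory Num.Theory.
Import numFieldNormedType.Exports.

Set Implicit Arguments.
Unset Strict Implicit.
Unset Printing Implicit Defensive.

Local Open Scope classical_set_scope.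
Local Open Scope ring_scope.

Definition user1 : 'I_3 := @Ordinal 3 0 isT.
Definition user2 : 'I_3 := @Ordinal 3 1 isT.
Definition user3 : 'I_3 := @Ordinal 3 2 isT.

(* The six ordered pairs (j, k) of distinct users; they index the messages
   m_jk and the rates R_jk. *)
Definition link := {p : 'I_3 * 'I_3 | p.1 != p.2}.
Definition tx (l : link) : 'I_3 := (val l).1.
Definition rx (l : link) : 'I_3 := (val l).2.

Notation mklink j k := (exist _ (j, k) isT : link) (only parsing).

Definition gains (n1 n2 n3 : nat) (j : 'I_3) : nat := nth 0%N [:: n1; n2; n3] j.

Section Channel.
Variable g : 'I_3 -> nat.

Definition nlevels : nat := \max_j g j.
Definition signal := 'cV['F_2]_nlevels.

Definition down_shift : 'M['F_2]_nlevels :=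
  \matrix_(i, j) (nat_of_ord i == j.+1)%:R.

Definition relay_output (x : 'I_3 -> signal) : signal :=
  \sum_(j < 3) (down_shift ^+ (nlevels - g j) *m x j).

Definition user_output (j : 'I_3) (xr : signal) : signal :=
  down_shift ^+ (nlevels - g j) *m xr.

(* [M l] is the size of the message set of the link [l], and [messages M P]
   the type of tuples of messages for the links satisfying [P]. *)
Definition messages (M : link -> nat) (P : pred link) :=
  {dffun forall l : {l : link | P l}, 'I_(M (val l))}.

Definition all_messages (M : link -> nat) := {dffun forall l : link, 'I_(M l)}.

Definition restrict_messages (M : link -> nat) (P : pred link)
    (m : all_messages M) : messages M P :=
  [ffun l : {l : link | P l} => m (val l)].

Definition sent_by (j : 'I_3) : pred link := fun l => tx l == j.
Definition intended_for (j : 'I_3) : pred link := fun l => rx l == j.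

(* Times are counted from 0, so that the signal sent at time [i] depends on
   exactly [i] past outputs. In a code of length [n] only the encoders with
   [i < n] are ever used. *)
Record code (n : nat) (M : link -> nat) := Code {
  user_enc : forall (j : 'I_3) (i : nat),
    messages M (sent_by j) -> i.-tuple signal -> signal;
  relay_enc : forall i : nat, i.-tuple signal -> signal;
  user_dec : forall j : 'I_3,
    n.-tuple signal -> messages M (sent_by j) -> messages M (intended_for j)
}.

Arguments user_enc {n M} c j i _ _.
Arguments relay_enc {n M} c i _.
Arguments user_dec {n M} c j _ _.

Section Transmission.
Variables (n : nat) (M : link -> nat) (c : code n M) (m : all_messages M).

(* The first [i] outputs at the relay and at each user. *)
Fixpoint outputs (i : nat) : i.-tuple signal * ('I_3 -> i.-tuple signal) :=
  if i is i'.+1 then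
    let yr := (outputs i').1 in
    let y := (outputs i').2 in
    let x j := user_enc c j i' (restrict_messages (sent_by j) m) (y j) in
    let xr := relay_enc c i' yr in
    ([tuple of rcons yr (relay_output x)],
     fun j => [tuple of rcons (y j) (user_output j xr)])
  else ([tuple], fun=> [tuple]).

Definition decoded (j : 'I_3) : messages M (intended_for j) :=
  user_dec c j ((outputs n).2 j) (restrict_messages (sent_by j) m).

Definition decoding_error : bool :=
  [exists j : 'I_3, decoded j != restrict_messages (intended_for j) m].

End Transmission.

Variable R : realType.

(* The messages are independent and uniform, so the tuple [m] has probability
   [\prod_l 1 / M l]. *)
Definition error_probability (n : nat) (M : link -> nat) (c : code n M) : R :=
  \sum_(m : all_messages M | decoding_error c m) \prod_(l : link) (M l)%:R^-1.

(* The number of integers [k] with [1 <= k <= 2 ^ (n * r l)]. *)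
Definition message_set_size (r : link -> R) (n : nat) (l : link) : nat :=
  Num.truncn (2 `^ (n%:R * r l)).

Definition achievable (r : link -> R) : Prop :=
  exists c : forall n : nat, code n (message_set_size r n),
    error_probability (c n) @[n --> \oo] --> (0 : R).

Definition capacity_region : set (link -> R) :=
  [set r | (forall l, 0 <= r l) /\ achievable r].

End Channel.

Definition outer_region (R : realType) (n1 n2 n3 : nat) : set (link -> R) :=
  [set r |
    let R12 := r (mklink user1 user2) in
    let R13 := r (mklink user1 user3) in
    let R21 := r (mklink user2 user1) in
    let R23 := r (mklink user2 user3) in
    let R31 := r (mklink user3 user1) in
    let R32 := r (mklink user3 user2) in
    (forall l, 0 <= r l) /\
    [/\ R12 + R32 + R13 <= n2%:R,
        R12 + R32 + R31 <= n1%:R,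
        R21 + R31 + R32 <= n2%:R &
        R21 + R31 + R23 <= n2%:R] /\
    [/\ R13 + R23 + R12 <= n2%:R,
        R13 + R23 + R21 <= n1%:R,
        R31 + R32 <= n3%:R &
        R13 + R23 <= n3%:R]].

Arguments capacity_region g R : clear implicits.
Arguments outer_region R n1 n2 n3 : clear implicits.

(* Main.v *)
(* Given a code, call a tuple of messages good if it is decoded correctly. Let
   [s] be a set of links without directed cycle. Two good tuples that agree
   outside [s] and produce the same outputs at every receiver of [s] are equal:
   a user all of whose messages are known decodes those intended for it, and one
   proceeds along the links of [s] backwards. The outputs at the receivers of
   [s] are determined by the output of the strongest of them, since the other
   outputs are shifts of it; they are also determined by the part of the relay
   input due to the senders of [s], since the other users' signals can be
   simulated. Either observation lies in the image of a power of the shift, of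
   size [2 ^ g w] for the strongest user [w] involved. So at most [2 ^ (n * g w)]
   good tuples agree outside [s], and since most tuples are good, the sum of the
   rates over [s] is at most [g w]. *)

Require Import Defs.
From mathcomp Require Import all_boot all_order all_algebra.
From mathcomp Require Import all_classical all_reals all_analysis.
From mathcomp Require Import ring lra.
Import Order.TTheory GRing.Theory Num.Theory.
Import numFieldNormedType.Exports.

Set Implicit Arguments.
Unset Strict Implicit.
Unset Printing Implicit Defensive.

Local Open Scope classical_set_scope.
Local Open Scope ring_scope.

(** * Size of the image of a power of the shift *)

Section ShiftImages.
Variable g : 'I_3 -> nat.
Implicit Types (x y : signal g) (d k : nat) (j w : 'I_3).

Lemma down_shift_exp_top k x (i : 'I_(nlevels g)) : (i < k)%N ->
  (down_shift g ^+ k *m x) i 0 = 0.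
Proof.
elim: k i => [//|k IH] i ik; rewrite exprS -mulmxA !mxE big1 // => j _.
rewrite !mxE; case: eqP => [ij|_]; last by rewrite mul0r.
by have := IH j; rewrite mxE => ->; rewrite ?mulr0 // -ltnS -ij.
Qed.

Definition shift_image d : pred (signal g) :=
  fun y => [exists x, y == down_shift g ^+ (nlevels g - d) *m x].

(** The shift fills the first [nlevels g - d] entries with zeros, so the remaining ones, at most [d]
    in number, determine a vector of the image. *)
Lemma card_shift_image d : (#|shift_image d| <= 2 ^ d)%N.
Proof.
(* The default 0 pads positions beyond [nlevels g], which occur only when [d] exceeds it. *)
pose top y : {ffun 'I_d -> 'F_2} :=
  [ffun a : 'I_d => oapp (y^~ 0) 0 (insub (nlevels g - d + a)%N)].
have top_inj : {in shift_image d &, injective top}.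
  move=> _ _ /existsP[x /eqP->] /existsP[x' /eqP->] /ffunP eq_top.
  apply/colP => i.
  have [lt_i|le_i] := ltnP i (nlevels g - d); first by rewrite !down_shift_exp_top.
  have lt_d : (i - (nlevels g - d) < d)%N.
    by rewrite ltn_subLR //; apply: leq_trans (ltn_ord i) _; rewrite addnC -leq_subLR.
  have := eq_top (Ordinal lt_d); rewrite !ffunE /= subnKC //.
  by rewrite valK.
have := leq_card_in _ _ top_inj.
by rewrite card_ffun !card_ord.
Qed.
End ShiftImages.

(** * What the observations determine, and successive decoding *)

Section Decoding.
Context {g : 'I_3 -> nat} {n : nat} {M : link -> nat} (c : Defs.code g n M).
Implicit Types (m : all_messages M) (i : nat) (j w : 'I_3) (s : seq link).

Definition user_signal m j i : signal g :=
  user_enc c (restrict_messages (sent_by j) m) ((outputs c m i).2 j).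

Definition relay_signal m i : signal g := relay_enc c (outputs c m i).1.

Definition partial_relay_output (P : pred 'I_3) m i : signal g :=
  \sum_(j < 3 | P j) down_shift g ^+ (nlevels g - g j) *m user_signal m j i.

Lemma rcons_tuple_inj (T : eqType) i (t t' : i.-tuple T) (x x' : T) :
  [tuple of rcons t x] = [tuple of rcons t' x'] -> t = t' /\ x = x'.
Proof. by move=> [/rcons_inj[eqt ->]]; split=> //; apply: val_inj. Qed.

Lemma eq_rcons_tuple (T : Type) i (t t' : i.-tuple T) (x x' : T) :
  t = t' -> x = x' -> [tuple of rcons t x] = [tuple of rcons t' x'].
Proof. by move=> -> ->. Qed.

Lemma eq_restrict_messages m m' (P : pred link) :
  (forall l, P l -> m l = m' l) -> restrict_messages P m = restrict_messages P m'.
Proof. by move=> eqm; apply/ffunP => -[l Pl]; rewrite !ffunE; apply: eqm. Qed.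

Lemma nlevels_sub_gain j w : (g j <= g w)%N ->
  (nlevels g - g j = (g w - g j) + (nlevels g - g w))%N.
Proof. by move=> gjw; rewrite addnC addnBA // subnK //; apply: leq_bigmax. Qed.

Lemma user_output_degraded j w (x x' : signal g) : (g j <= g w)%N ->
  user_output w x = user_output w x' -> user_output j x = user_output j x'.
Proof.
move=> gjw; rewrite /user_output => eqw.
by rewrite (nlevels_sub_gain gjw) exprD -!mulmxA eqw.
Qed.

Lemma eq_user_outputs m m' j w i : (g j <= g w)%N ->
  (forall i', (i' < i)%N -> user_output w (relay_signal m i') =
                            user_output w (relay_signal m' i')) ->
  (outputs c m i).2 j = (outputs c m' i).2 j.
Proof.
move=> gjw; elim: i => [//|i IH] eqw /=; apply: eq_rcons_tuple.
  by apply: IH => i' lt_i'; apply: eqw; apply: ltnW.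
by apply: (user_output_degraded gjw); apply: eqw.
Qed.

(** The relay encodes from its own past outputs alone, so these fix everything the users have
    received. *)
Lemma eq_user_outputs_of_relay m m' j i :
  (outputs c m i).1 = (outputs c m' i).1 ->
  (outputs c m i).2 j = (outputs c m' i).2 j.
Proof.
elim: i => [//|i IH] /= /rcons_tuple_inj[eqr _].
by apply: eq_rcons_tuple; [exact: IH | rewrite eqr].
Qed.

(** Induction on time. Equal past outputs at the relay give equal past outputs at the users, so a
    user outside [P], having the same messages too, sends the same signal; the hypothesis on
    [partial_relay_output] accounts for the users in [P]. *)
Lemma eq_relay_outputs (P : pred 'I_3) m m' i :
  (forall l, ~~ P (tx l) -> m l = m' l) ->
  (forall i', (i' < i)%N ->
     partial_relay_output P m i' = partial_relay_output P m' i') ->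
  (outputs c m i).1 = (outputs c m' i).1.
Proof.
move=> eqm; elim: i => [//|i IH] eqO /=.
have eqr : (outputs c m i).1 = (outputs c m' i).1.
  by apply: IH => i' lt_i'; apply: eqO; apply: ltnW.
have eqx : relay_output (user_signal m ^~ i) = relay_output (user_signal m' ^~ i).
  have split x : relay_output x =
      \sum_(j < 3 | P j) down_shift g ^+ (nlevels g - g j) *m x j +
      \sum_(j < 3 | ~~ P j) down_shift g ^+ (nlevels g - g j) *m x j.
    exact: bigID.
  rewrite 2!split (eqO i (ltnSn i) : \sum_(_ < 3 | _) _ = _).
  apply: (f_equal (+%R _)); apply: eq_bigr => j Pj; apply: f_equal.
  rewrite /user_signal.
  rewrite (eq_user_outputs_of_relay _ eqr) (@eq_restrict_messages m m') //.
  by move=> l /eqP tl; apply: eqm; rewrite tl.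
by apply: eq_rcons_tuple.
Qed.

(** The decoder of [j] gets the same input in both cases, and its result is correct for both
    tuples. *)
Lemma eq_intended_messages m m' j :
  ~~ decoding_error c m -> ~~ decoding_error c m' ->
  (outputs c m n).2 j = (outputs c m' n).2 j ->
  (forall l, tx l = j -> m l = m' l) -> forall l, rx l = j -> m l = m' l.
Proof.
rewrite !negb_exists => /forallP/(_ j)/negPn/eqP dm /forallP/(_ j)/negPn/eqP dm'.
move=> eqy eqm l rl.
have : restrict_messages (intended_for j) m = restrict_messages (intended_for j) m'.
  rewrite -dm -dm' /decoded eqy (@eq_restrict_messages m m') //.
  by move=> k /eqP; apply: eqm.
have Pl : intended_for j l by apply/eqP.
by move=> /ffunP/(_ (exist _ l Pl)); rewrite !ffunE.
Qed.

(* Users decode in the order of increasing [h]: the links of [s] leaving a user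
   are then already known when that user decodes. *)
Lemma acyclic_decoding (s : seq link) (h : 'I_3 -> nat) m m' :
  {in s, forall l, (h (rx l) < h (tx l))%N} ->
  ~~ decoding_error c m -> ~~ decoding_error c m' ->
  {in s, forall l, (outputs c m n).2 (rx l) = (outputs c m' n).2 (rx l)} ->
  (forall l, l \notin s -> m l = m' l) -> m = m'.
Proof.
move=> hs em em' eqy eqm; apply/ffunP.
suff main a l : (h (rx l) < a)%N -> m l = m' l by move=> l; apply: main (ltnSn _).
elim: a l => [//|a IH] l lt_a.
have [ls|/eqm//] := boolP (l \in s).
apply: (eq_intended_messages em em' (eqy l ls)) => // k tk.
have [ks|/eqm//] := boolP (k \in s).
by apply: IH; rewrite -ltnS (leq_trans _ lt_a) // ltnS -tk hs.
Qed.
End Decoding.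

(** * Counting the error-free message tuples *)

Section Counting.
Implicit Types (M : link -> nat) (s : seq link).

Lemma card_messages M P : #|messages M P| = (\prod_(l | P l) M l)%N.
Proof.
rewrite card_dep_ffun foldrE big_map big_enum /=.
under eq_bigr do rewrite card_ord.
by rewrite -(big_sub P M).
Qed.

Lemma card_all_messages M : #|all_messages M| = (\prod_l M l)%N.
Proof.
rewrite card_dep_ffun foldrE big_map big_enum /=.
by under eq_bigr do rewrite card_ord.
Qed.

Variables (g : 'I_3 -> nat) (n : nat) (M : link -> nat) (c : Defs.code g n M).

(** Pairing the [n] observations with the messages outside [s] is injective on good tuples; the
    bound counts the possible pairs. *)
Lemma error_free_count s d (obs : all_messages M -> nat -> signal g) :
  (forall m i, obs m i \in @shift_image g d) ->
  (forall m m', ~~ decoding_error c m -> ~~ decoding_error c m' ->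
     (forall i, (i < n)%N -> obs m i = obs m' i) ->
     (forall l, l \notin s -> m l = m' l) -> m = m') ->
  (#|[set m | ~~ decoding_error c m]%SET| <=
     2 ^ (d * n) * \prod_(l | l \notin s) M l)%N.
Proof.
move=> obs_im obs_inj.
pose f m := ([ffun i : 'I_n => obs m i], restrict_messages [pred l | l \notin s] m).
rewrite -(@card_in_imset _ _ f); last first.
  move=> m m'; rewrite !inE => em em' -[/ffunP eqo /ffunP eqm].
  apply: obs_inj => // [i lt_i|l ls].
    by have := eqo (Ordinal lt_i); rewrite !ffunE.
  by have := eqm (exist _ l ls); rewrite !ffunE.
pose T := finset.setX
  [set F : {ffun 'I_n -> signal g} | F \in ffun_on (@shift_image g d)]%SET
  [set: messages M [pred l | l \notin s]]%SET.
apply: (@leq_trans #|T|).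
  apply/subset_leq_card/fintype.subsetP => _ /imsetP[m _ ->].
  by rewrite !inE andbT; apply/ffun_onP => i; rewrite ffunE; apply: obs_im.
rewrite cardsX cardsT card_messages cardsE card_ffun_on card_ord expnM leq_mul //.
by have [->|n0] := posnP n; [rewrite !expn0 | rewrite leq_exp2r // card_shift_image].
Qed.

(** The tuples are equiprobable, and positivity of every [M l] makes the total mass 1, so the
    success probability is the proportion of good tuples. *)
Lemma success_probabilityE (R : realType) : (forall l, (0 < M l)%N) ->
  1 - error_probability R c =
  #|[set m | ~~ decoding_error c m]%SET|%:R / (\prod_l M l)%:R.
Proof.
move=> M0.
have PM0 : (\prod_l M l)%:R != 0 :> R.
  by rewrite pnatr_eq0 -lt0n prodn_gt0.
have total : \sum_(m : all_messages M) \prod_(l : link) (M l)%:R^-1 = 1 :> R.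
  by rewrite sumr_const card_all_messages prodfV -natr_prod -[LHS]mulr_natl divff.
transitivity (\sum_(m | ~~ decoding_error c m) \prod_(l : link) (M l)%:R^-1 : R).
  rewrite -[X in X - _]total (bigID (decoding_error c)) /=.
  by rewrite /error_probability addrC addrK.
rewrite sumr_const prodfV -natr_prod -[LHS]mulr_natl; congr (_%:R / _).
by apply: eq_card => m; rewrite !inE.
Qed.
End Counting.

(** * From message counts to rates *)

(** Rounding down a real that is at least 1 loses at most a factor 2. *)
Lemma powR2_le_message_set_size (R : realType) (r : link -> R) n l :
  0 <= r l -> 2 `^ (n%:R * r l) <= 2 * (message_set_size r n l)%:R.
Proof.
move=> r0; rewrite /message_set_size.
have M1 : 1 <= 2 `^ (n%:R * r l) :> R.
  by rewrite -[leLHS](powRr0 2) ler_powR ?ler1n // mulr_ge0.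
have lt_M := truncnS_gt (2 `^ (n%:R * r l)).
have : (0 < Num.truncn (2 `^ (n%:R * r l) : R))%N by rewrite truncn_gt0.
rewrite -(ler_nat R) => M0; apply/ltW/(lt_le_trans lt_M).
by rewrite -natr1; lra.
Qed.

(** Once the error is below 1/2, the message sets of [s] have product at most [2 * 2 ^ (d * n)].
    Rounding costs a factor 2 per link, so a sum of rates above [d] by [delta] would force
    [n * delta] to stay bounded. *)
Lemma sum_rates_le (R : realType) (g : 'I_3 -> nat) (r : link -> R)
    (c : forall n, Defs.code g n (message_set_size r n)) (s : seq link) (d : nat) :
  (forall l, 0 <= r l) -> uniq s ->
  error_probability R (c n) @[n --> \oo] --> (0 : R) ->
  (forall n, (#|[set m | ~~ decoding_error (c n) m]%SET| <=
     2 ^ (d * n) * \prod_(l | l \notin s) message_set_size r n l)%N) ->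
  \sum_(l <- s) r l <= d%:R.
Proof.
move=> r0 us err0 count.
pose M := message_set_size r.
have M0 n l : (0 < M n l)%N.
  by rewrite truncn_gt0 -[leLHS](powRr0 2) ler_powR ?ler1n // mulr_ge0.
(* Dividing the count by the number of all tuples cancels the factor of the links outside [s]. *)
have success n :
    (1 - error_probability R (c n)) * (\prod_(l <- s) M n l)%:R <= 2 ^+ (d * n).
  rewrite success_probabilityE; last exact: M0.
  rewrite (bigID (mem s)) /= -(big_uniq _ us) /= natrM.
  have := count n; rewrite -(ler_nat R) natrM natrX.
  rewrite -/M; set G := _%:R; set A := (\prod_(_ <- _) _)%:R.
  set B := (\prod_(_ | _) _)%:R => leG.
  have A0 : 0 < A by rewrite ltr0n prodn_gt0.
  have B0 : 0 < B by rewrite ltr0n prodn_gt0.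
  have -> : G / (A * B) * A = G / B.
    by field; rewrite !gt_eqF.
  by rewrite ler_pdivrMr.
have size_ge n :
    2 `^ (n%:R * \sum_(l <- s) r l) <= 2 ^+ size s * (\prod_(l <- s) M n l)%:R.
  elim: s {us count success} => [|l s IH] /=.
    by rewrite !big_nil mulr0 powRr0 expr0 mulr1.
  rewrite !big_cons mulrDr powRD ?pnatr_eq0 ?implybT // natrM exprS mulrACA.
  by rewrite ler_pM ?powR_ge0 // powR2_le_message_set_size.
rewrite leNgt; apply/negP => lt_d.
pose delta := \sum_(l <- s) r l - d%:R.
have delta0 : 0 < delta by rewrite subr_gt0.
have half : \forall n \near \oo, error_probability R (c n) < 2^-1.
  by apply: (cvgr_lt 0 err0); rewrite invr_gt0.
(* Of the [size s + 2] bits, [size s] pay for rounding, one for the success probability 1/2, and one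
   makes the contradiction strict. *)
have large : \forall n \near \oo, (size s).+2%:R / delta < n%:R :> R.
  exact: nbhs_infty_gtr.
have [n [err_lt]] := filter_ex (filterI half large).
rewrite ltr_pdivrMr // => n_gt.
have : 2 `^ (n%:R * \sum_(l <- s) r l) <= 2 ^+ ((size s).+1 + d * n) :> R.
  apply: (le_trans (size_ge n)).
  rewrite addSnnS exprD ler_pM2l ?exprn_gt0 // exprS.
  by have := success n; have : 0 <= (\prod_(l <- s) M n l)%:R :> R by []; nra.
apply/negP; rewrite -ltNge.
apply: (@lt_le_trans _ _ (2 `^ ((size s).+2 + d * n)%:R)).
  by rewrite powR_mulrn // ltr_eXn2l ?ltr1n.
rewrite ler_powR ?ler1n // natrD natrM.
by move: n_gt; rewrite /delta mulrBr; nra.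
Qed.

(** * Downlink and uplink bounds, and the eight inequalities *)

Lemma user_output_image (g : 'I_3 -> nat) j (x : signal g) :
  user_output j x \in @shift_image g (g j).
Proof. by apply/existsP; exists x. Qed.

(** The power of the shift belonging to [w] factors out of every summand, since no user in [P] is
    stronger than [w]. *)
Lemma partial_relay_output_image (g : 'I_3 -> nat) n M (c : Defs.code g n M)
    (P : pred 'I_3) w m i : (forall j, P j -> (g j <= g w)%N) ->
  partial_relay_output c P m i \in @shift_image g (g w).
Proof.
move=> gP; apply/existsP.
exists (\sum_(j < 3 | P j) down_shift g ^+ (g w - g j) *m user_signal c m j i).
apply/eqP; rewrite mulmx_sumr; apply: eq_bigr => j Pj.
by rewrite (nlevels_sub_gain (gP j Pj)) addnC exprD -mulmxA.
Qed.

Section Bounds.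
Variables (R : realType) (g : 'I_3 -> nat) (r : link -> R).
Variables (s : seq link) (h : 'I_3 -> nat) (w : 'I_3).
Hypotheses (r_cap : capacity_region g R r) (s_uniq : uniq s).
Hypothesis s_acyclic : {in s, forall l, (h (rx l) < h (tx l))%N}.

Lemma downlink_bound : {in s, forall l, (g (rx l) <= g w)%N} ->
  \sum_(l <- s) r l <= (g w)%:R.
Proof.
case: r_cap => r0 [c err0] gw.
apply: (sum_rates_le r0 s_uniq err0) => n.
apply: (@error_free_count _ _ _ _ _ _
          (fun m i => user_output w (relay_signal (c n) m i))).
  by move=> m i; apply: user_output_image.
move=> m m' em em' eqy; apply: (acyclic_decoding s_acyclic em em') => l ls.
by apply: eq_user_outputs eqy; apply: gw.
Qed.

Lemma uplink_bound : {in s, forall l, (g (tx l) <= g w)%N} ->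
  \sum_(l <- s) r l <= (g w)%:R.
Proof.
case: r_cap => r0 [c err0] gw.
apply: (sum_rates_le r0 s_uniq err0) => n.
apply: (@error_free_count _ _ _ _ _ _
          (partial_relay_output (c n) [in map tx s])).
  by move=> m i; apply: partial_relay_output_image => _ /mapP[l ls ->]; apply: gw.
move=> m m' em em' eqy eqm.
apply: (acyclic_decoding s_acyclic em em') => // l _.
(* A link whose sender sends no link of [s] lies outside [s], so its message is common to both
   tuples. *)
apply: eq_user_outputs_of_relay; apply: eq_relay_outputs eqy => k Nk.
by apply: eqm; apply: contra Nk; apply: map_f.
Qed.
End Bounds.

Theorem theorem2 (R : realType) (n1 n2 n3 : nat) (h12 : (n2 <= n1)%N)
    (h23 : (n3 <= n2)%N) :
  capacity_region (gains n1 n2 n3) R `<=` outer_region R n1 n2 n3.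
Proof.
move=> r r_cap.
have down := downlink_bound r_cap; have up := uplink_bound r_cap.
split; first by case: r_cap.
split; split.
(* In each case the [index] list gives the users in decoding order, and the last argument is the
   strongest receiver for [down], the strongest sender for [up]. *)
- have := down [:: mklink user1 user2; mklink user3 user2; mklink user1 user3]
    (index^~ [:: user2; user3; user1]) user2.
  rewrite !big_cons big_nil addr0 addrA; apply=> //; apply/allP => //.
  by rewrite /= h23 leqnn.
- have := down [:: mklink user1 user2; mklink user3 user2; mklink user3 user1]
    (index^~ [:: user2; user1; user3]) user1.
  rewrite !big_cons big_nil addr0 addrA; apply=> //; apply/allP => //.
  by rewrite /= h12 leqnn.
- have := up [:: mklink user2 user1; mklink user3 user1; mklink user3 user2]
    (index^~ [:: user1; user2; user3]) user2.
  rewrite !big_cons big_nil addr0 addrA; apply=> //; apply/allP => //.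
  by rewrite /= h23 leqnn.
- have := up [:: mklink user2 user1; mklink user3 user1; mklink user2 user3]
    (index^~ [:: user1; user3; user2]) user2.
  rewrite !big_cons big_nil addr0 addrA; apply=> //; apply/allP => //.
  by rewrite /= h23 leqnn.
- have := down [:: mklink user1 user3; mklink user2 user3; mklink user1 user2]
    (index^~ [:: user3; user2; user1]) user2.
  rewrite !big_cons big_nil addr0 addrA; apply=> //; apply/allP => //.
  by rewrite /= h23 leqnn.
- have := down [:: mklink user1 user3; mklink user2 user3; mklink user2 user1]
    (index^~ [:: user3; user1; user2]) user1.
  rewrite !big_cons big_nil addr0 addrA; apply=> //; apply/allP => //.
  by rewrite /= (leq_trans h23 h12) leqnn.
(* Here [user3] is the only sender, and in the next bound the only receiver, whence [n3]. *)
- have := up [:: mklink user3 user1; mklink user3 user2]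
    (index^~ [:: user1; user2; user3]) user3.
  rewrite !big_cons big_nil addr0; apply=> //; apply/allP => //.
  by rewrite /= leqnn.
- have := down [:: mklink user1 user3; mklink user2 user3]
    (index^~ [:: user3; user1; user2]) user3.
  rewrite !big_cons big_nil addr0; apply=> //; apply/allP => //.
  by rewrite /= leqnn.
Qed.
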